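(* Assume that the Jacobian $G'$ is globally Lipschitz continuous with constant $L_1>0$, i.e. $\|G'(\mathbf u)-G'(\mathbf v)\|\le L_1\|\mathbf u-\mathbf v\|$ for all $\mathbf u,\mathbf v\in\mathbb R^{n(N+1)}$. Let $c>0$ be an upper bound on the norm of the initial error, $\|\mathbf e_0\|\le c$, and let $\alpha>0$ be such that for every $\mathbf x\in\mathbb R^{n(N+1)}$ the matrix $G'(\mathbf x)^TG'(\mathbf x)+\alpha H^TH$ is invertible and $$\big\|\big(G'(\mathbf x)^TG'(\mathbf x)+\alpha H^TH\big)^{-1}G'(\mathbf x)^T\big\|\le (L_1c)^{-1}.$$ Assume that the observations are noise-free, i.e. $\mathbf y=H\mathbf u^\dagger$. Let $(\mathbf u^{(k)})_{k\ge0}$ be the Gauss-Newton data-assimilation iteration with this $\alpha$, and let $\mathbf e_k=\mathbf u^{(k)}-\mathbf u^\dagger$. Then $\lim_{k\to\infty}\|\mathbf e_k\|=0$.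
   Context: Norms: $\|\cdot\|$ is the Euclidean norm for vectors (in any dimension) and the induced operator norm for matrices. Model: let $n,N\ge1$ and let $F_j:\mathbb R^n\to\mathbb R^n$, $j=0,\dots,N-1$, be twice continuously differentiable. The true solution $\mathbf u^\dagger=(u_0^\dagger,\dots,u_N^\dagger)\in\mathbb R^{n(N+1)}$ satisfies $u^\dagger_{j+1}=F_j(u^\dagger_j)$ for $j=0,\dots,N-1$. For $\mathbf u=(u_0,\dots,u_N)\in\mathbb R^{n(N+1)}$ define $G(\mathbf u)=(G_0(\mathbf u),\dots,G_{N-1}(\mathbf u))^T\in\mathbb R^{nN}$ with $G_j(\mathbf u)=u_{j+1}-F_j(u_j)$. The Jacobian $G'(\mathbf u)$ is the block bidiagonal matrix whose $j$-th block row ($j=0,\dots,N-1$) has $-F_j'(u_j)$ in block column $j$, the identity $I$ in block column $j+1$, and zeros elsewhere. Observations: at time indices $0\le k_0<\dots<k_M\le N$ one has linear observation operators $\mathcal H_{k_i}:\mathbb R^n\to\mathbb R^p$, $p\le n$, and observations $y_{k_i}=\mathcal H_{k_i}u^\dagger_{k_i}+\eta_{k_i}$, where $\eta_{k_i}$ is the observation noise (zero in the noise-free case). Put $\mathbf y=(y_{k_0},\dots,y_{k_M})$, and let $H$ be the linear map $H\mathbf u=(\mathcal H_{k_0}u_{k_0},\dots,\mathcal H_{k_M}u_{k_M})$ on $\mathbb R^{n(N+1)}$. Gauss-Newton data-assimilation iteration with parameter $\alpha$: the initial guess is $\mathbf u^{(0)}=H^T\mathbf y+(I-H^TH)\mathbf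 u^b$, where $\mathbf u^b\in\mathbb R^{n(N+1)}$ is a given background solution, and for $k\ge0$ $$\mathbf u^{(k+1)}=\mathbf u^{(k)}-\big(G'(\mathbf u^{(k)})^TG'(\mathbf u^{(k)})+\alpha H^TH\big)^{-1}\big(G'(\mathbf u^{(k)})^TG(\mathbf u^{(k)})+\alpha H^T(H\mathbf u^{(k)}-\mathbf y)\big).$$ *)

(* Defs.v *)
From mathcomp Require Export all_boot all_order all_algebra.
From mathcomp Require Export all_classical all_reals all_analysis.

Set Implicit Arguments.
Unset Strict Implicit.
Unset Printing Implicit Defensive.

Import Order.TTheory GRing.Theory Num.Theory.
Import numFieldNormedType.Exports.

Local Open Scope classical_set_scope.
Local Open Scope ring_scope.

(* The library norm on matrices is the max-entry norm, so the Euclidean norm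
   and the operator norm it induces are defined here. *)
Definition enorm (R : realType) (m : nat) (x : 'cV[R]_m) : R :=
  Num.sqrt (\sum_(i < m) x i 0 ^+ 2).

Definition opnorm (R : realType) (m q : nat) (A : 'M[R]_(m, q)) : R :=
  sup [set enorm (A *m x) | x in [set x : 'cV[R]_q | enorm x <= 1]].

(* Unlike the library's [jacobian], which acts on row vectors from the right,
   this is the usual Jacobian, acting on column vectors from the left. *)
Definition jac (R : realType) (m q : nat) (f : 'cV[R]_m -> 'cV[R]_q)
    (x : 'cV[R]_m) : 'M[R]_(q, m) :=
  \matrix_(i < q, j < m) ('d f x (delta_mx j 0 : 'cV[R]_m)) i 0.

Lemma mul_jac (R : realType) (m q : nat) (f : 'cV[R]_m -> 'cV[R]_q)
    (x v : 'cV[R]_m) : jac f x *m v = 'd f x v.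
Proof.
have -> : 'd f x v = \sum_j v j 0 *: 'd f x (delta_mx j 0 : 'cV[R]_m).
  rewrite [in LHS](matrix_sum_delta v) linear_sum; apply: eq_bigr => j _.
  by rewrite big_ord1 linearZ.
apply/matrixP => i k; rewrite ord1 !mxE summxE; apply: eq_bigr => j _.
by rewrite !mxE mulrC.
Qed.

Definition C1 (R : realType) (m q : nat) (f : 'cV[R]_m -> 'cV[R]_q) : Prop :=
  (forall x, differentiable f x) /\ continuous (jac f).

(* The matrix-valued derivative is flattened to a vector-valued function, so
   that its own Jacobian collects all second-order partial derivatives. *)
Definition C2 (R : realType) (m q : nat) (f : 'cV[R]_m -> 'cV[R]_q) : Prop :=
  C1 f /\ C1 (fun x => (mxvec (jac f x))^T).

(* R^{mN}, seen as stacked column vectors (u_0, ..., u_{N-1}) of size m. *)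
Notation bvec R N m := 'cV[R]_(\sum_(j < N) m).

Definition blk (R : realType) (m N : nat) (u : bvec R N m) (j : 'I_N) :
  'cV[R]_m := @submxcol R N (fun=> m) 1 u j.

(* Time indices j and j + 1 in {0, ..., N}, for j in {0, ..., N-1}. *)
Definition cur (N : nat) (j : 'I_N) : 'I_N.+1 := widen_ord (leqnSn N) j.
Definition nxt (N : nat) (j : 'I_N) : 'I_N.+1 := lift ord0 j.

Section Model.
Variables (R : realType) (n N : nat) (F : 'I_N -> 'cV[R]_n -> 'cV[R]_n).

Definition trajectory (u : bvec R N.+1 n) : Prop :=
  forall j : 'I_N, blk u (nxt j) = F j (blk u (cur j)).

Definition dynG (u : bvec R N.+1 n) : bvec R N n :=
  \mxcol_(j < N) (blk u (nxt j) - F j (blk u (cur j))).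

Definition dynG' (u : bvec R N.+1 n) :
    'M[R]_(\sum_(j < N) n, \sum_(j < N.+1) n) :=
  \mxblock_(j < N, i < N.+1)
    (if i == cur j then - jac (F j) (blk u (cur j)) else
     if i == nxt j then 1%:M else 0).

End Model.

Section Observations.
Variables (R : realType) (n N p M : nat).
Variables (k : 'I_M.+1 -> 'I_N.+1) (Hobs : 'I_M.+1 -> 'M[R]_(p, n)).

(* The matrix of u |-> (Hobs_0 u_{k_0}, ..., Hobs_M u_{k_M}). *)
Definition obsH : 'M[R]_(\sum_(i < M.+1) p, \sum_(j < N.+1) n) :=
  \mxblock_(i < M.+1, j < N.+1) (if j == k i then Hobs i else 0).

End Observations.

Section GaussNewton.
Variables (R : realType) (n N p M : nat).
Variables (F : 'I_N -> 'cV[R]_n -> 'cV[R]_n).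
Variables (H : 'M[R]_(\sum_(i < M.+1) p, \sum_(j < N.+1) n)).
Variables (alpha : R).

Definition gn_mx (u : bvec R N.+1 n) : 'M[R]_(\sum_(j < N.+1) n) :=
  (dynG' F u)^T *m dynG' F u + alpha *: (H^T *m H).

Variables (y : bvec R M.+1 p) (ub : bvec R N.+1 n).

Definition gn_init : bvec R N.+1 n := H^T *m y + (1%:M - H^T *m H) *m ub.

Definition gn_step (u : bvec R N.+1 n) : bvec R N.+1 n :=
  u - invmx (gn_mx u) *m
        ((dynG' F u)^T *m dynG F u + alpha *: (H^T *m (H *m u - y))).

Fixpoint gauss_newton (l : nat) : bvec R N.+1 n :=
  if l is l'.+1 then gn_step (gauss_newton l') else gn_init.

End GaussNewton.

(* Main.v *)
Require Import Defs.
From mathcomp Require Import ring lra.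

Set Implicit Arguments.
Unset Strict Implicit.
Unset Printing Implicit Defensive.

Import Order.TTheory GRing.Theory Num.Theory.
Import numFieldNormedType.Exports.

Local Open Scope classical_set_scope.
Local Open Scope ring_scope.

(** Noise-free data and a true trajectory make udag a zero of both residuals,
    dynG udag = 0 and y = H udag.  With A(u) the Gauss-Newton matrix, the
    observation terms then cancel out of the error of one step, and what is left
    is the linearisation error of the dynamics alone ([gn_step_error]):

      u_{l+1} - udag
        = A(u_l)^-1 G'(u_l)^T (G(udag) - G(u_l) - G'(u_l) (udag - u_l)).

    The first factor is at most 1 / (L1 c) by hypothesis, and the Taylor
    remainder is at most L1 / 2 |e_l|^2 because G' is L1-Lipschitz
    ([taylor_lipschitz]), so |e_{l+1}| <= |e_l|^2 / (2 c).  Starting from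
    |e_0| <= c, the errors stay below c, hence at least halve at each step
    ([quadratic_halving]).

    The factor 1 / 2 in the Taylor bound is essential: the mean value inequality
    applied to the remainder would only give |e_{l+1}| <= |e_l|^2 / c, which
    allows |e_l| = c forever.  It is obtained without integrating G', by pairing
    the remainder with itself: this reduces the bound to the monotonicity of a
    real function of t with a quadratic correction term. *)

(** * Euclidean and operator norms *)

Section EuclideanNorm.
Variable R : realType.

Lemma enorm_ge0 m (x : 'cV[R]_m) : 0 <= enorm x.
Proof. exact: sqrtr_ge0. Qed.

Lemma sqr_enorm m (x : 'cV[R]_m) : enorm x ^+ 2 = \sum_i x i 0 ^+ 2.
Proof. by rewrite sqr_sqrtr // sumr_ge0 // => i _; rewrite sqr_ge0. Qed.

Lemma enorm0 m : enorm (0 : 'cV[R]_m) = 0.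
Proof. by rewrite /enorm big1 ?sqrtr0 // => i _; rewrite mxE expr0n. Qed.

Lemma enorm_eq0 m (x : 'cV[R]_m) : enorm x = 0 -> x = 0.
Proof.
move=> x0; have /psumr_eq0P sx0 : \sum_i x i 0 ^+ 2 = 0.
  by rewrite -sqr_enorm x0 expr0n.
apply/colP => i; rewrite mxE; apply/eqP; rewrite -sqrf_eq0.
by rewrite sx0 // => j _; rewrite sqr_ge0.
Qed.

Lemma enormZ m (a : R) (x : 'cV[R]_m) : enorm (a *: x) = `|a| * enorm x.
Proof.
rewrite /enorm -sqrtr_sqr -sqrtrM ?sqr_ge0 // mulr_sumr.
by congr Num.sqrt; apply: eq_bigr => i _; rewrite mxE exprMn.
Qed.

Lemma enormN m (x : 'cV[R]_m) : enorm (- x) = enorm x.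
Proof. by rewrite -scaleN1r enormZ normrN normr1 mul1r. Qed.

Lemma CauchySchwarz_sum m (a b : 'I_m -> R) :
  (\sum_i a i * b i) ^+ 2 <= (\sum_i a i ^+ 2) * (\sum_i b i ^+ 2).
Proof.
set A := \sum_i a i ^+ 2; set B := \sum_i b i ^+ 2; set D := \sum_i a i * b i.
(* Lagrange's identity: the defect is a sum of squares. *)
have lagrange : \sum_i \sum_j (a i * b j - a j * b i) ^+ 2
    = (A * B - D ^+ 2) *+ 2.
  transitivity (\sum_i (a i ^+ 2 * B + b i ^+ 2 * A - (a i * b i * D) *+ 2)).
    apply: eq_bigr => i _.
    rewrite !mulr_sumr -sumrMnl -big_split -sumrB /=; apply: eq_bigr => j _.
    ring.
  rewrite sumrB big_split -!mulr_suml -/A -/B sumrMnl -mulr_suml -/D /=; ring.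
rewrite -subr_ge0 -(pmulrn_lge0 _ (isT : (0 < 2)%N)) -lagrange.
by apply: sumr_ge0 => i _; apply: sumr_ge0 => j _; apply: sqr_ge0.
Qed.

Definition dotp m (x y : 'cV[R]_m) : R := \sum_i x i 0 * y i 0.

Lemma dotpB m (x y z : 'cV[R]_m) : dotp x (y - z) = dotp x y - dotp x z.
Proof. by rewrite -sumrB; apply: eq_bigr => i _; rewrite !mxE mulrBr. Qed.

Lemma dotpp m (x : 'cV[R]_m) : dotp x x = enorm x ^+ 2.
Proof. by rewrite sqr_enorm; apply: eq_bigr => i _; rewrite expr2. Qed.

Lemma dotp_le m (x y : 'cV[R]_m) : dotp x y <= enorm x * enorm y.
Proof.
rewrite (le_trans (ler_norm _)) // -sqrtr_sqr -sqrtrM.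
  by rewrite ler_wsqrtr // CauchySchwarz_sum.
by rewrite sumr_ge0 // => i _; rewrite sqr_ge0.
Qed.

(** The Frobenius norm bounds the supremum in [opnorm], which would otherwise be
    a junk value. *)
Lemma enorm_mulmx_bounded m q (A : 'M[R]_(m, q)) (x : 'cV[R]_q) :
  enorm (A *m x) <= Num.sqrt (\sum_i \sum_j A i j ^+ 2) * enorm x.
Proof.
rewrite -sqrtrM; last by do 2!apply: sumr_ge0 => ? _; apply: sqr_ge0.
apply: ler_wsqrtr; rewrite mulr_suml; apply: ler_sum => i _; rewrite mxE.
exact: CauchySchwarz_sum.
Qed.

Lemma enorm_mulmx m q (A : 'M[R]_(m, q)) (x : 'cV[R]_q) :
  enorm (A *m x) <= opnorm A * enorm x.
Proof.
have [x0|x_gt0] := eqVneq (enorm x) 0.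
  by rewrite (enorm_eq0 x0) mulmx0 !enorm0 mulr0.
have {}x_gt0 : 0 < enorm x by rewrite lt_def x_gt0 enorm_ge0.
rewrite -ler_pdivrMr // mulrC -{1}(ger0_norm (enorm_ge0 x)) -normfV -enormZ.
rewrite scalemxAr; apply: ub_le_sup.
  exists (Num.sqrt (\sum_i \sum_j A i j ^+ 2)) => _ [z /= z_le1 <-].
  apply: le_trans (enorm_mulmx_bounded A z) _.
  by rewrite -[leRHS]mulr1 ler_wpM2l ?sqrtr_ge0.
exists ((enorm x)^-1 *: x) => //=.
by rewrite enormZ normfV ger0_norm ?enorm_ge0 // mulVf ?gt_eqF.
Qed.

End EuclideanNorm.

(** * Directional derivatives and the Taylor remainder *)

Section Derivatives.
Variable R : realType.

(** The two difference quotients are the same function of the increment.  This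
    chain rule serves for the restriction to a line as well as for the extraction
    of a block. *)
Lemma is_derive_affine (V V' W : normedModType R) (f : V' -> W) (l : V -> V')
    (x v : V) (w : V') (d : W) :
  (forall s : R, l (s *: v + x) = s *: w + l x) ->
  is_derive (l x) w f d -> is_derive x v (f \o l) d.
Proof.
move=> lE [fd fdE].
have E : (fun s : R => s^-1 *: ((f \o l \o shift x) (s *: v) - (f \o l) x))
       = (fun s : R => s^-1 *: ((f \o shift (l x)) (s *: w) - f (l x))).
  by apply/funext => s /=; rewrite lE.
by split; rewrite /derivable /derive E.
Qed.

Lemma is_derive_mxP (V : normedModType R) m q (f : V -> 'M[R]_(m, q)) x v D :
  is_derive x v f D <-> forall i j, is_derive x v (fun y => f y i j) (D i j).
Proof.
split=> [[fd fdE] i j|fd].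
  split; first by have /derivable_mxP := fd; apply.
  by rewrite -fdE derive_mx // mxE.
have fder : derivable f x v by apply/derivable_mxP => i j; case: (fd i j).
split => //; rewrite derive_mx //; apply/matrixP => i j; rewrite mxE.
by case: (fd i j).
Qed.

Section Taylor.
Variables (m q : nat) (G : 'cV[R]_m -> 'cV[R]_q) (J : 'cV[R]_m -> 'M[R]_(q, m)).
Hypothesis dG : forall x v : 'cV[R]_m, is_derive x v G (J x *m v).

Lemma is_derive_dotp_line (r : 'cV[R]_q) (x h : 'cV[R]_m) (t : R) :
  is_derive t 1 (fun s => dotp r (G (s *: h + x)))
    (dotp r (J (t *: h + x) *m h)).
Proof.
have dGi i : is_derive t 1 (fun s => G (s *: h + x) i 0)
    ((J (t *: h + x) *m h) i 0).
  apply: (is_derive_affine (f := fun y => G y i 0)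
    (l := fun s : R => s *: h + x) (w := h)) => [s|].
    by rewrite scalerDl -addrA [_%:A]mulr1.
  by have /is_derive_mxP := dG (t *: h + x) h; apply.
have -> : (fun s => dotp r (G (s *: h + x)))
    = \sum_i (r i 0 *: (fun s => G (s *: h + x) i 0)).
  by apply/funext => s; rewrite fct_sumE.
exact: is_derive_sum.
Qed.

(** Let r be the remainder.  Along the segment, <r, G(x + t h)> has slope
    <r, J(x + t h) h>, which exceeds <r, J(x) h> by at most t L |r| |h|^2.  So
    [phi], which subtracts a primitive of this bound, is nonincreasing, and
    phi 1 <= phi 0 reads |r|^2 <= L / 2 |r| |h|^2. *)
Lemma taylor_lipschitz (L : R) (x h : 'cV[R]_m) :
  0 <= L -> (forall u v, opnorm (J u - J v) <= L * enorm (u - v)) ->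
  enorm (G (h + x) - G x - J x *m h) <= L / 2 * enorm h ^+ 2.
Proof.
move=> L_ge0 J_lip; set r := _ - _.
pose a := dotp r (J x *m h); pose b := L / 2 * (enorm r * enorm h ^+ 2).
pose phi (t : R) := dotp r (G (t *: h + x)) - a * t - b * t ^+ 2.
have dphi (t : R) : is_derive t (1 : R) phi
    (dotp r (J (t *: h + x) *m h) - a - (b * t) *+ 2).
  have D1 := is_derive_dotp_line r x h t.
  have D2 : is_derive t (1 : R) (fun s : R => a * s) a.
    by apply: is_derive_eq; rewrite [LHS]mulr1.
  have D3 : is_derive t (1 : R) (fun s : R => b * s ^+ 2) ((b * t) *+ 2).
    by apply: is_derive_eq; rewrite /GRing.scale /=; ring.
  exact: is_deriveB.
have phi_le : phi 1 <= phi 0.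
  apply: (@ler0_derive1_le_cc R phi 0 1); rewrite ?in_itv /= ?lexx ?ler01 //.
  - move=> t; rewrite in_itv /= => /andP[t_gt0 _].
    rewrite derive1E (derive_val (is_derive := dphi t)) /a -dotpB -mulmxBl.
    rewrite subr_le0.
    apply: le_trans (dotp_le _ _) _.
    have -> : (b * t) *+ 2 = enorm r * (L * (t * enorm h) * enorm h).
      by rewrite /b; field.
    rewrite ler_wpM2l ?enorm_ge0 //; apply: le_trans (enorm_mulmx _ _) _.
    rewrite ler_wpM2r ?enorm_ge0 //; apply: le_trans (J_lip _ _) _.
    by rewrite addrK enormZ gtr0_norm.
  - by apply: derivable_within_continuous => t _; case: (dphi t).
have [r0|r_gt0] := eqVneq (enorm r) 0.
  by rewrite r0 mulr_ge0 ?divr_ge0 ?sqr_ge0.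
have {}r_gt0 : 0 < enorm r by rewrite lt_def r_gt0 enorm_ge0.
have rr : dotp r r = dotp r (G (h + x)) - dotp r (G x) - a.
  by rewrite /a -!dotpB.
rewrite -(ler_pM2l r_gt0) -expr2 -(dotpp r) rr.
move: phi_le; rewrite /phi /b scale1r scale0r add0r.
lra.
Qed.

End Taylor.
End Derivatives.

(** * The Gauss-Newton iteration *)

(** This justifies calling the block bidiagonal matrix the Jacobian of the
    dynamics, and makes [taylor_lipschitz] applicable to [dynG]. *)
Lemma is_derive_dynG (R : realType) (n N : nat)
    (F : 'I_N -> 'cV[R]_n -> 'cV[R]_n) (u v : bvec R N.+1 n) :
  (forall j x, differentiable (F j) x) ->
  is_derive u v (dynG F) (dynG' F u *m v).
Proof.
move=> dF.
have blkP j (w : bvec R N.+1 n) (s : R) :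
    blk (s *: w + u) j = s *: blk w j + blk u j.
  by rewrite /blk submxcolD; congr (_ + _); apply/matrixP => a b; rewrite !mxE.
have dG' : dynG' F u *m v =
    \mxcol_j (blk v (nxt j) - jac (F j) (blk u (cur j)) *m blk v (cur j)).
  rewrite -[v in LHS]submxcolK mul_mxblock_mxrow; apply: eq_mxcol => j.
  have cn : nxt j != cur j by rewrite -val_eqE /= /bump /= add1n gtn_eqF.
  rewrite (bigD1 (cur j)) //= eqxx (bigD1 (nxt j)) //= (negPf cn) eqxx.
  rewrite big1 => [|i /andP[/negPf -> /negPf ->]]; last by rewrite mul0mx.
  by rewrite addr0 mulNmx mul1mx addrC.
rewrite dG'; apply/is_derive_mxP => a b; rewrite mxE.
(* An entry of the stacked vector is an entry of one of its blocks. *)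
have -> : (fun y => dynG F y a b) = (fun y =>
    (blk y (nxt (tagnat.sig1 a)) - F (tagnat.sig1 a) (blk y (cur (tagnat.sig1 a))))
       (tagnat.sig2 a) b).
  by apply/funext => y; rewrite mxE.
move: (tagnat.sig1 a) (tagnat.sig2 a) => j i.
suff /is_derive_mxP/(_ i b) : is_derive u v
    (fun y => blk y (nxt j) - F j (blk y (cur j)))
    (blk v (nxt j) - jac (F j) (blk u (cur j)) *m blk v (cur j)) by [].
apply: is_deriveB.
  exact: (is_derive_affine (f := id) (l := fun y => blk y (nxt j))).
apply: (is_derive_affine (f := F j) (l := fun y => blk y (cur j))) => //.
by rewrite mul_jac -deriveE //; apply/derivableP/diff_derivable.
Qed.

(** After multiplication by the Gauss-Newton matrix both sides expand; the terms
    in alpha cancel because the data are H udag, and G(udag) vanishes on a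
    trajectory.  That zero is kept on the right so that the last factor is a
    Taylor remainder at [u]. *)
Lemma gn_step_error (R : realType) (n N p M : nat)
    (F : 'I_N -> 'cV[R]_n -> 'cV[R]_n)
    (H : 'M[R]_(\sum_(i < M.+1) p, \sum_(j < N.+1) n)) (alpha : R)
    (udag u : bvec R N.+1 n) :
  trajectory F udag -> gn_mx F H alpha u \in unitmx ->
  gn_step F H alpha (H *m udag) u - udag =
  invmx (gn_mx F H alpha u) *m (dynG' F u)^T *m
    (dynG F udag - dynG F u - dynG' F u *m (udag - u)).
Proof.
move=> udagP Au.
have -> : dynG F udag = 0.
  by apply/mxcolP => j; rewrite mxcolK submxcol0 udagP subrr.
rewrite -[LHS](mulKmx Au) -mulmxA; congr (invmx _ *m _).
rewrite /gn_step addrAC mulmxBr mulKVmx // /gn_mx mulmxDl.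
rewrite -scalemxAl -!mulmxA -(mulmxBr H) opprD addrACA subrr addr0 -mulmxBr.
by rewrite sub0r -[udag - u]opprB mulmxN opprK [in RHS]addrC.
Qed.

(** The true rate is doubly exponential; the geometric bound is the simplest one
    that gives convergence and keeps e l <= c along the induction. *)
Lemma quadratic_halving (R : realType) (c : R) (e : nat -> R) :
  0 < c -> (forall l, 0 <= e l) -> e 0%N <= c ->
  (forall l, e l.+1 <= (c * 2)^-1 * e l ^+ 2) ->
  forall l, e l <= c * 2^-1 ^+ l.
Proof.
move=> c_gt0 e_ge0 e0 eS; elim=> [|l IHl]; first by rewrite mulr1.
have el_c : e l <= c.
  by rewrite (le_trans IHl) // ler_piMr ?(ltW c_gt0) // exprn_ile1 //; lra.
rewrite exprSr mulrA; apply: le_trans (eS l) _.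
apply: (@le_trans _ _ (e l / 2)); last by rewrite ler_wpM2r.
rewrite ler_pdivrMl ?mulr_gt0 // expr2.
have -> : c * 2 * (e l / 2) = c * e l by field.
by rewrite ler_wpM2r.
Qed.

Theorem theorem1 (R : realType) (n N p M : nat)
    (n_ge1 : (1 <= n)%N) (N_ge1 : (1 <= N)%N) (p_le_n : (p <= n)%N)
    (F : 'I_N -> 'cV[R]_n -> 'cV[R]_n) (F_C2 : forall j, C2 (F j))
    (udag : bvec R N.+1 n) (udagP : trajectory F udag)
    (k : 'I_M.+1 -> 'I_N.+1)
    (k_incr : forall i j : 'I_M.+1, (i < j)%N -> (k i < k j)%N)
    (Hobs : 'I_M.+1 -> 'M[R]_(p, n))
    (y : bvec R M.+1 p) (ub : bvec R N.+1 n)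
    (L1 c alpha : R) (L1_gt0 : 0 < L1) (c_gt0 : 0 < c) (alpha_gt0 : 0 < alpha)
    (G'_lip : forall u v : bvec R N.+1 n,
       opnorm (dynG' F u - dynG' F v) <= L1 * enorm (u - v))
    (e0_le : enorm (gauss_newton F (obsH k Hobs) alpha y ub 0 - udag) <= c)
    (alphaP : forall x : bvec R N.+1 n,
       gn_mx F (obsH k Hobs) alpha x \in unitmx /\
       opnorm (invmx (gn_mx F (obsH k Hobs) alpha x) *m (dynG' F x)^T)
         <= (L1 * c)^-1)
    (noise_free : y = obsH k Hobs *m udag) :
  (fun l => enorm (gauss_newton F (obsH k Hobs) alpha y ub l - udag))
    @ \oo --> (0 : R).

Proof.
set e := fun l => _.
have e_ge0 l : 0 <= e l by exact: enorm_ge0.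
have e_step l : e l.+1 <= (c * 2)^-1 * e l ^+ 2.
  rewrite /e /=; set u := gauss_newton _ _ _ _ _ l.
  have [Au Ale] := alphaP u.
  rewrite noise_free gn_step_error // -[u - udag]opprB enormN.
  have res_le : enorm (dynG F udag - dynG F u - dynG' F u *m (udag - u))
      <= L1 / 2 * enorm (udag - u) ^+ 2.
    rewrite -{1}[udag](subrK u).
    apply: (taylor_lipschitz _ _ _ (ltW L1_gt0) G'_lip) => x v.
    by apply: is_derive_dynG => j z; case: (F_C2 j) => -[].
  apply: le_trans (enorm_mulmx _ _) _.
  apply: le_trans (ler_wpM2r (enorm_ge0 _) Ale) _.
  apply: le_trans (ler_wpM2l _ res_le) _; first by rewrite invr_ge0 mulr_ge0 ?ltW.
  rewrite le_eqVlt; apply/orP; left; apply/eqP; field.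
  by rewrite !gt_eqF.
have e_le := quadratic_halving c_gt0 e_ge0 e0_le e_step.
apply: (@squeeze_cvgr _ _ _ _ (cst 0) (fun l => c * 2^-1 ^+ l)).
- by near=> l; rewrite e_ge0 e_le.
- exact: cvg_cst.
- rewrite -(mulr0 c); apply: cvgM; first exact: cvg_cst.
  by apply: cvg_expr; rewrite ger0_norm; lra.
Unshelve. all: by end_near.
Qed.
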